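(* Let $\Bbbk$ be an infinite field, let $t\in\Bbbk$, and let $\mathbf{a}=(a_0,\dots,a_n)\in\mathbb{Z}_{\ge 0}^{n+1}$ be a sequence of $n+1$ nonnegative integers with $d=|\mathbf{a}|=\sum_{i=0}^n a_i$. Then the following identity holds in $\Bbbk[X_0,\dots,X_n]$: $$D_{\mathbf{a}}\cdot X_0^{a_0}X_1^{a_1}\cdots X_n^{a_n}=\sum_{Z_{\mathbf{a}}\subset A\subset E_{\mathbf{a}}}\ \sum_{(\mathbf{k},\mathbf{s})\in K_A\times\overline{S_A}} C_{A,\mathbf{k},\mathbf{s}}\,(\ell_{A,\mathbf{k},\mathbf{s}})^d,$$ where $$D_{\mathbf{a}}=(-1)^{|Z_{\mathbf{a}}|}\cdot 2^n\cdot\binom{d}{\mathbf{a}}\cdot\prod_{i\notin Z_{\mathbf{a}}}F_i(t^{a_i})$$ and $$C_{A,\mathbf{k},\mathbf{s}}=(-1)^{|A|}\cdot 2^{|A|}\cdot(-1)^{\sum_{i\notin A}a_i s_i}\prod_{i\in A}F_i(1)\prod_{i\notin A}c(y^{k_i},F_i).$$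
   Context: All indices $i$ range over $\{0,1,\dots,n\}$; ''$i\notin A$'' means $i\in\{0,\dots,n\}\setminus A$. Inclusions $\subset$ are not necessarily strict. Empty products equal $1$, and $0^0=1$. For $\mathbf{a}=(a_0,\dots,a_n)\in\mathbb{Z}_{\ge0}^{n+1}$: - $\binom{d}{\mathbf{a}}=\frac{d!}{a_0!\,a_1!\cdots a_n!}$ is the multinomial coefficient, where $d=|\mathbf{a}|$. - $Z_{\mathbf{a}}=\{i : a_i=0\}$, $E_{\mathbf{a}}=\{i : a_i\text{ is even}\}$ (so $Z_{\mathbf a}\subset E_{\mathbf a}$), and $m_i=\lfloor\frac{a_i-1}{2}\rfloor$. - For a set $A$ with $Z_{\mathbf{a}}\subset A\subset E_{\mathbf{a}}$: $K_A=\{(k_i)_{i\notin A} : k_i\in\mathbb{Z},\ 0\le k_i\le m_i\text{ for } i\notin A\}$; $S_A=\{(s_i)_{i\notin A} : s_i\in\{0,1\}\}$; and $\overline{S_A}=\{(s_i)_{i\notin A}\in S_A : s_{\min\{i : i\notin A\}}=0\}$. - For $\mathbf{k}\in K_A$, $\mathbf{s}\in S_A$: $\ell_{A,\mathbf{k},\mathbf{s}}=\sum_{i\notin A}(-1)^{s_i}t^{k_i}X_i$, a linear form in $\Bbbk[X_0,\dots,X_n]$. - $F_i(y)\in\Bbbk[y]$ is $F_i(y)=\prod_{j=1}^{m_i}(y-t^{a_i-2j})$ if $m_i>0$, and $F_i(y)=1$ if $m_i=-1$ or $m_i=0$. - For a monomial $M$ and a polynomial $f$ in $\Bbbk[y]$,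 $c(M,f)$ is the coefficient of $M$ in $f$. Convention: if all $a_i$ are even, the choice $A=\{0,\dots,n\}$ is omitted from the sum (there is no associated linear form).
   Formalization: The formal statement assumes d ≥ 1 (a is not the zero sequence): for a = 0 the only A is {0,…,n}, which the convention omits, so the right side is 0 while D_a = (-1)^{n+1}·2^n is nonzero, e.g. over the rationals. *)

(* Defs.v *)
From HB Require Import structures.
From mathcomp Require Import all_boot all_order all_algebra.
From mathcomp Require Import mpoly.

Set Implicit Arguments.
Unset Strict Implicit.
Unset Printing Implicit Defensive.

Import GRing.Theory.
Local Open Scope ring_scope.

(* A sequence (a_0, ..., a_n) is a multi-exponent a : 'X_{1..n.+1}, so that
   |a| is mdeg a and X_0^{a_0} ... X_n^{a_n} is 'X_[a].                      *)

Definition multinomial (n : nat) (a : 'X_{1..n}) : nat :=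
  ((mdeg a)`! %/ \prod_(i < n) (a i)`!)%N.

Definition Zset (n : nat) (a : 'X_{1..n}) : {set 'I_n} :=
  [set i | a i == 0%N].

Definition Eset (n : nat) (a : 'X_{1..n}) : {set 'I_n} :=
  [set i | ~~ odd (a i)].

(* floor ((a_i - 1) / 2); truncated, hence 0 instead of -1 when a_i = 0.  The
   two values give the same F_i = 1, and K_A only involves indices i with
   a_i > 0.                                                                  *)
Definition mhalf (n : nat) (a : 'X_{1..n}) (i : 'I_n) : nat := (a i).-1./2.

(* Families indexed by {i | i \notin A} are finite functions on all indices
   that take the default value (0, resp. false) on A.  The bounded codomain of
   k is no restriction, as m_i <= a_i <= mdeg a.                             *)
Definition Kset (n : nat) (a : 'X_{1..n}) (A : {set 'I_n}) :
    {set {ffun 'I_n -> 'I_(mdeg a).+1}} :=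
  [set k in pfamily ord0 (mem (~: A))
              (fun i => [pred j : 'I_(mdeg a).+1 | (j <= mhalf a i)%N])].

Definition Sset (n : nat) (A : {set 'I_n}) : {set {ffun 'I_n -> bool}} :=
  [set s in pffun_on false (mem (~: A)) predT].

Definition is_min_notin (n : nat) (A : {set 'I_n}) (i : 'I_n) : bool :=
  (i \notin A) && [forall j : 'I_n, (j \notin A) ==> (i <= j)%N].

Definition Sbar (n : nat) (A : {set 'I_n}) : {set {ffun 'I_n -> bool}} :=
  [set s in Sset A | [forall i : 'I_n, is_min_notin A i ==> (s i == false)]].

Definition Fpoly (K : fieldType) (t : K) (n : nat) (a : 'X_{1..n}) (i : 'I_n) :
    {poly K} :=
  \prod_(1 <= j < (mhalf a i).+1) ('X - (t ^+ (a i - 2 * j))%:P).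

Definition ell (K : fieldType) (t : K) (n d : nat) (A : {set 'I_n})
    (k : {ffun 'I_n -> 'I_d}) (s : {ffun 'I_n -> bool}) : {mpoly K[n]} :=
  \sum_(i < n | i \notin A) ((-1) ^+ s i * t ^+ k i) *: 'X_i.

Definition Dcoef (K : fieldType) (t : K) (n : nat) (a : 'X_{1..n.+1}) : K :=
  (-1) ^+ #|Zset a| * 2 ^+ n * (multinomial a)%:R
  * \prod_(i < n.+1 | i \notin Zset a) (Fpoly t a i).[t ^+ a i].

Definition Ccoef (K : fieldType) (t : K) (n d : nat) (a : 'X_{1..n})
    (A : {set 'I_n}) (k : {ffun 'I_n -> 'I_d}) (s : {ffun 'I_n -> bool}) : K :=
  (-1) ^+ #|A| * 2 ^+ #|A| * (-1) ^+ (\sum_(i < n | i \notin A) a i * s i)%N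
  * \prod_(i < n | i \in A) (Fpoly t a i).[1]
  * \prod_(i < n | i \notin A) (Fpoly t a i)`_(k i).

(* Main.v *)
Require Import Defs.
From HB Require Import structures.
From mathcomp Require Import all_boot all_order all_algebra.
From mathcomp Require Import classical_sets cardinality.
From mathcomp Require Import mpoly.
From mathcomp Require Import zify ring.

Set Implicit Arguments.
Unset Strict Implicit.
Unset Printing Implicit Defensive.

Import GRing.Theory.
Local Open Scope ring_scope.

(** Compare the coefficients of X^b, |b| = d.  By the multinomial theorem, the
    coefficient on the right is a sum over A, k, s of products over the indices,
    hence a product over i of local factors.  Up to normalisation, the factor at
    i is F_i(t^(b_i)) if b_i has the parity of a_i and 0 otherwise; for even
    a_i > 0 the terms with i in A subtract F_i(1) when b_i = 0.  As F_i vanishes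
    at t^(a_i - 2j), the factor is 0 whenever b_i < a_i, and |b| = |a| leaves
    only b = a.  Summing s over the half-set Sbar instead of dividing the full
    sum by 2 makes the argument valid in characteristic 2. *)

(** * Multinomial coefficients and powers of linear forms *)

Section Multinomial.

Variable n : nat.
Implicit Types (b : 'X_{1..n}) (i : 'I_n).

Lemma prod_fact_mnmB1 b i : (0 < b i)%N ->
  (\prod_(j < n) (b j)`! = b i * \prod_(j < n) ((b - U_(i))%MM j)`!)%N.
Proof.
move=> bi_gt0; rewrite (bigD1 i) //= [in RHS](bigD1 i) //=.
rewrite mnmBE mnm1E eqxx subn1 mulnA -{1}(prednK bi_gt0) factS prednK //.
congr (_ * _)%N; apply: eq_bigr => j ji.
by rewrite mnmBE mnm1E eq_sym (negPf ji) subn0.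
Qed.

Lemma mdegB1 b i : (0 < b i)%N -> mdeg b = (mdeg (b - U_(i))%MM).+1.
Proof.
move=> bi_gt0; have le_ib : (U_(i) <= b)%MM by rewrite lep1mP -lt0n.
by rewrite -{1}(submK le_ib) mdegD mdeg1 addn1.
Qed.

Lemma fact_mdeg_rec b : (0 < mdeg b)%N ->
  ((mdeg b)`! = \sum_(i < n | (0 < b i)%N) b i * (mdeg (b - U_(i))%MM)`!)%N.
Proof.
move=> b_gt0; rewrite -{1}(prednK b_gt0) factS prednK // {1}mdegE big_distrl /=.
rewrite (bigID (fun i => (0 < b i)%N)) /= [X in (_ + X)%N]big1 ?addn0.
  by apply: eq_bigr => i bi_gt0; rewrite (mdegB1 bi_gt0).
by move=> i; rewrite -eqn0Ngt => /eqP->.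
Qed.

(** [multinomial] is a truncated quotient; this makes it exact. By induction on the degree, every
    summand of [fact_mdeg_rec] is divisible. *)
Lemma dvdn_prod_fact_mnm b : (\prod_(i < n) (b i)`! %| (mdeg b)`!)%N.
Proof.
move: {2}(mdeg b) (erefl (mdeg b)) => d.
elim: d b => [|d IHd] b deg_b.
  move/eqP: (deg_b); rewrite mdeg_eq0 => /eqP->.
  by rewrite big1 // => i _; rewrite mnm0E.
rewrite fact_mdeg_rec ?deg_b //; apply: dvdn_sum => i bi_gt0.
rewrite (prod_fact_mnmB1 bi_gt0) dvdn_mul // IHd //.
by apply: succn_inj; rewrite -(mdegB1 bi_gt0).
Qed.

(** Pascal's rule: [fact_mdeg_rec] divided by the product of the factorials. *)
Lemma multinomial_rec b : (0 < mdeg b)%N ->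
  multinomial b = (\sum_(i < n | (0 < b i)%N) multinomial (b - U_(i))%MM)%N.
Proof.
move=> b_gt0; have fact_gt0' c : (0 < \prod_(i < n) (c i)`!)%N.
  by rewrite prodn_gt0 // => i; apply: fact_gt0.
apply/eqP; rewrite -(eqn_pmul2r (fact_gt0' b)).
rewrite /multinomial divnK ?dvdn_prod_fact_mnm // fact_mdeg_rec // big_distrl /=.
apply/eqP/eq_bigr => i bi_gt0; rewrite (prod_fact_mnmB1 bi_gt0) mulnCA.
by rewrite divnK ?dvdn_prod_fact_mnm.
Qed.

(** Induction on [d]: in the last factor the term in ['X_i] picks up the coefficient at [b - U_(i)],
    and Pascal's rule sums these up. *)
Lemma mcoeff_linear_exp (R : comNzRingType) (c : 'I_n -> R) d b :
  ((\sum_(i < n) c i *: 'X_i) ^+ d : {mpoly R[n]})@_b =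
  if mdeg b == d then (multinomial b)%:R * \prod_(i < n) c i ^+ b i else 0.
Proof.
elim: d b => [|d IHd] b.
  rewrite expr0 mcoeff1 mdeg_eq0; case: eqP => // ->.
  rewrite /multinomial mdeg0 !big1 ?divn1 ?mulr1 // => i _; by rewrite mnm0E.
rewrite exprSr mulr_sumr raddf_sum /=.
have coef_step i : ((\sum_(j < n) c j *: 'X_j) ^+ d * (c i *: 'X_i))@_b =
    if (0 < b i)%N then
      c i * ((\sum_(j < n) c j *: 'X_j) ^+ d : {mpoly R[n]})@_(b - U_(i))%MM
    else 0.
  rewrite -scalerAr mcoeffZ; case: ltnP => [bi_gt0|].
    have le_ib : (U_(i) <= b)%MM by rewrite lep1mP -lt0n.
    by rewrite -{1}(submK le_ib) addmC mcoeffMX.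
  rewrite leqn0 => /eqP bi0; rewrite [X in _ * X]memN_msupp_eq0 ?mulr0 //.
  rewrite (perm_mem (msuppMX _ _)); apply/mapP=> -[m _ def_b].
  by move: bi0; rewrite def_b mnmDE mnm1E eqxx.
rewrite (eq_bigr _ (fun i _ => coef_step i)) -big_mkcond /=.
case: eqP => [deg_b|deg_b]; last first.
  apply: big1 => i bi_gt0; rewrite IHd ifF ?mulr0 //.
  by apply/eqP => deg_bi; apply: deg_b; rewrite (mdegB1 bi_gt0) deg_bi.
rewrite multinomial_rec ?deg_b // natr_sum mulr_suml.
apply: eq_bigr => i bi_gt0; rewrite IHd ifT; last first.
  by apply/eqP/succn_inj; rewrite -(mdegB1 bi_gt0).
rewrite mulrCA; congr (_ * _).
rewrite (bigD1 i) //= [in RHS](bigD1 i) //= mulrA mnmBE mnm1E eqxx subn1.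
rewrite -exprS prednK //; congr (_ * _); apply: eq_bigr => j ji.
by rewrite mnmBE mnm1E eq_sym (negPf ji) subn0.
Qed.

End Multinomial.

(** * Sums over the half-set of signs and over the exponents [k] *)

Lemma Sbar_pfamily (n : nat) (A : {set 'I_n}) :
  Sbar A =i pfamily false (mem (~: A)) (fun i b => is_min_notin A i ==> ~~ b).
Proof.
move=> s; rewrite !finset.in_set.
apply/andP/idP => [[/pfamilyP[sA _] /forallP smin]|].
  apply/pfamilyP; split=> // i _; rewrite unfold_in.
  by have := smin i; rewrite eqbF_neg.
move=> /pfamilyP[sA smin]; split; first by apply/pfamilyP; split.
apply/forallP=> i; rewrite eqbF_neg; have [iA|/negPn iA] := boolP (i \notin A).
  by have := smin i; rewrite !inE => /(_ iA).
by rewrite /is_min_notin iA.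
Qed.

Lemma is_min_notin_exists (n : nat) (A : {set 'I_n}) : A != finset.setT ->
  exists2 m : 'I_n, m \notin A & forall i, is_min_notin A i = (i == m).
Proof.
rewrite -finset.subTset => /subsetPn[i0 _ i0A].
case: (@arg_minnP _ i0 (fun i => i \notin A) (@nat_of_ord n) i0A) => m mA m_min.
exists m => // i; apply/andP/eqP => [[iA /forallP i_min]|->].
  apply/val_inj/eqP; rewrite eqn_leq m_min // andbT.
  by have := i_min m; rewrite mA.
by split=> //; apply/forallP => j; apply/implyP/m_min.
Qed.

(* The sign at the least index is frozen to 0; its parity condition is
   recovered from the parity of the total. *)
Lemma sum_Sbar_sign (R : comNzRingType) (n : nat) (A : {set 'I_n})
    (e : 'I_n -> nat) :
    A != finset.setT -> ~~ odd (\sum_(i < n | i \notin A) e i) ->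
  \sum_(s in Sbar A) \prod_(i < n | i \notin A) (-1) ^+ (e i * s i) =
  2 ^+ #|~: A|.-1 * \prod_(i < n | i \notin A) (~~ odd (e i))%:R :> R.
Proof.
move=> AT even_e; have [m mA minE] := is_min_notin_exists AT.
(* Membership in [Sbar] is a condition on each index separately, so the sum distributes into a
   product of sums over single signs. *)
rewrite (eq_bigl _ _ (Sbar_pfamily A)).
transitivity (\prod_(i in ~: A)
    \sum_(b : bool | is_min_notin A i ==> ~~ b) ((-1) ^+ (e i * b) : R)).
  rewrite (big_distr_big_dep false); apply: eq_bigr => s _.
  by apply: eq_bigl => i; rewrite inE.
have mA' : m \in ~: A by rewrite inE.
rewrite (bigD1 m) //= minE eqxx big_mkcond big_bool /= muln0 add0r mul1r.
have free_sum i : (i \in ~: A) && (i != m) ->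
    \sum_(b : bool | is_min_notin A i ==> ~~ b) ((-1) ^+ (e i * b) : R) =
    2 * (~~ odd (e i))%:R.
  case/andP=> _ im; rewrite minE (negPf im) big_bool /= muln0 muln1.
  rewrite -signr_odd; case: (odd _) => /=; first by rewrite mulr0 addNr.
  by rewrite mulr1.
rewrite (eq_bigr _ free_sum) big_split /= prodr_const; congr (_ ^+ _ * _).
  rewrite [in RHS](cardD1 m) mA' add1n /=; apply: eq_card => i.
  by rewrite -!topredE /= andbC.
have [odd_m|even_m] := boolP (odd (e m)); last first.
  rewrite [in RHS](bigD1 m) //= even_m mul1r; apply: eq_bigl => i.
  by rewrite inE.
(* With [e m] odd the right side is 0. The total being even, another index is odd as well, and its
   factor makes the left side 0. *)
have [/existsP[i /and3P[iA im odd_i]]|] :=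
    boolP [exists i, [&& i \notin A, i != m & odd (e i)]].
  rewrite (bigD1 i) /= ?inE ?iA // odd_i mul0r.
  by rewrite [RHS](bigD1 m) //= odd_m mul0r.
rewrite negb_exists => /forallP none_odd; case/negP: even_e.
rewrite (bigD1 m) //= oddD odd_m /=.
apply: (big_ind (fun k => ~~ odd k)) => // [x y /negPf x0 /negPf y0|i /andP[iA im]].
  by rewrite oddD x0 y0.
by have := none_odd i; rewrite iA im.
Qed.

(** By distributivity the sum splits into one sum per index, which is the expansion of F_i at [x i]
    because F_i has degree m_i. *)
Lemma sum_Kset (K : fieldType) (t : K) (n : nat) (a : 'X_{1..n})
    (A : {set 'I_n}) (x : 'I_n -> K) :
  \sum_(k in Kset a A)
    \prod_(i < n | i \notin A) ((Fpoly t a i)`_(k i) * x i ^+ k i) =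
  \prod_(i < n | i \notin A) (Fpoly t a i).[x i].
Proof.
transitivity (\prod_(i in ~: A)
    \sum_(j : 'I_(mdeg a).+1 | (j <= mhalf a i)%N) (Fpoly t a i)`_j * x i ^+ j).
  rewrite (big_distr_big_dep ord0); apply: eq_big => [k|k _].
    by rewrite finset.in_set.
  by apply: eq_bigl => i; rewrite inE.
apply: eq_big => [i|i _]; first by rewrite inE.
have sizeF : (size (Fpoly t a i) <= (mhalf a i).+1)%N.
  rewrite /Fpoly -(big_map (fun j => t ^+ (a i - 2 * j)) predT
    (fun z => 'X - z%:P)) size_prod_XsubC size_map size_iota.
  by rewrite subn1.
(* The codomain of [k] is large enough to reach every coefficient of F_i. *)
have le_mhalf : ((mhalf a i).+1 <= (mdeg a).+1)%N.
  rewrite ltnS /mhalf leq_half_double (leq_trans (leq_pred _)) //.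
  by rewrite mdegE (bigD1 i) //= -addnn -!addnA -addnS leq_addr.
rewrite (horner_coef_wide _ sizeF).
rewrite (big_ord_widen _ (fun j => (Fpoly t a i)`_j * x i ^+ j) le_mhalf).
by apply: eq_bigl => j; rewrite ltnS.
Qed.

(** * The coefficient of ['X_[b]] as a product of local factors *)

Section Coefficients.

Variables (K : fieldType) (t : K) (n : nat) (a b : 'X_{1..n.+1}).

(* Half the contribution of the index i to the coefficient of 'X_[b] in the
   summand of A, according to whether i belongs to A. *)
Definition inside (i : 'I_n.+1) : K := - (Fpoly t a i).[1] * (b i == 0%N)%:R.
Definition outside (i : 'I_n.+1) : K := (odd (a i) == odd (b i))%:R * (Fpoly t a i).[t ^+ b i].

(** Extend the linear form by zero coefficients on [A]; as 0^0 = 1, their powers become the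
    indicators of b_i = 0. *)
Lemma mcoeff_ell_exp (d : nat) (A : {set 'I_n.+1}) (k : {ffun 'I_n.+1 -> 'I_d})
    (s : {ffun 'I_n.+1 -> bool}) :
  (ell t A k s ^+ mdeg a)@_b =
  if mdeg b == mdeg a then
    (multinomial b)%:R * ((\prod_(i in A) (b i == 0%N)%:R) *
      \prod_(i < n.+1 | i \notin A) ((-1) ^+ s i * t ^+ k i) ^+ b i)
  else 0.
Proof.
have -> : ell t A k s =
    \sum_i (if i \notin A then (-1) ^+ s i * t ^+ k i else 0) *: 'X_i.
  rewrite /ell big_mkcond; apply: eq_bigr => i _.
  by case: ifP => // _; rewrite scale0r.
rewrite mcoeff_linear_exp; case: ifP => // _; congr (_ * _).
rewrite (bigID (mem A)) /=; congr (_ * _).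
  by apply: eq_bigr => i ->; rewrite expr0n.
by apply: eq_bigr => i ->.
Qed.

Lemma sum_Ccoef_mcoeff (A : {set 'I_n.+1}) :
    mdeg b = mdeg a -> A \subset Eset a -> A != finset.setT ->
  \sum_(k in Kset a A) \sum_(s in Sbar A)
     Ccoef t a A k s * (ell t A k s ^+ mdeg a)@_b =
  2 ^+ n * (multinomial b)%:R *
  ((\prod_(i in A) inside i) * \prod_(i < n.+1 | i \notin A) outside i).
Proof.
move=> deg_b AE AT.
(* If some b_i with i in [A] is nonzero, both sides vanish. *)
have [/existsP[i /andP[iA bi]]|b0] := boolP [exists i, (i \in A) && (b i != 0%N)].
  rewrite (bigD1 i iA) /= {1}/inside (negPf bi) mulr0 !mul0r mulr0.
  apply: big1 => k _; apply: big1 => s _; rewrite mcoeff_ell_exp deg_b eqxx.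
  by rewrite (bigD1 i iA) /= (negPf bi) !mul0r !mulr0.
have {}b0 i : i \in A -> b i = 0%N.
  move=> iA; apply/eqP; move: b0; rewrite negb_exists => /forallP/(_ i).
  by rewrite iA /= negbK.
(* The exponent of the sign at i: a_i comes from [Ccoef], b_i from the power of [ell]. Over all
   indices the total is 2d, and those in [A] contribute even numbers. *)
pose e i := (a i + b i)%N.
have even_e : ~~ odd (\sum_(i < n.+1 | i \notin A) e i).
  have : ~~ odd (\sum_(i < n.+1) e i).
    by rewrite big_split /= -!mdegE deg_b addnn odd_double.
  rewrite (bigID (mem A)) /= oddD.
  suff /negPf-> : ~~ odd (\sum_(i in A) e i) by [].
  apply: (big_ind (fun k => ~~ odd k)) => // [x y /negPf x0 /negPf y0|i iA].
    by rewrite oddD x0 y0.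
  by rewrite /e b0 // addn0; have := fintype.subsetP AE _ iA; rewrite inE.
(* Separate the dependence on [k] from that on [s], so that the two sums can be evaluated
   independently. *)
have summandE k s : Ccoef t a A k s * (ell t A k s ^+ mdeg a)@_b =
    (multinomial b)%:R * 2 ^+ #|A| * (\prod_(i in A) inside i) *
    ((\prod_(i < n.+1 | i \notin A) ((Fpoly t a i)`_(k i) * (t ^+ b i) ^+ k i)) *
    \prod_(i < n.+1 | i \notin A) (-1) ^+ (e i * s i)).
  rewrite mcoeff_ell_exp deg_b eqxx /Ccoef.
  have -> : \prod_(i in A) inside i =
      (-1) ^+ #|A| * (\prod_(i in A) (Fpoly t a i).[1]) *
      \prod_(i in A) (b i == 0%N)%:R.
    rewrite -prodr_const -!big_split; apply: eq_bigr => i _ /=.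
    by rewrite mulN1r.
  have -> : \prod_(i < n.+1 | i \notin A) (-1) ^+ (e i * s i) =
      (-1) ^+ (\sum_(i < n.+1 | i \notin A) a i * s i)%N *
      \prod_(i < n.+1 | i \notin A) ((-1) ^+ s i) ^+ b i :> K.
    rewrite expr_sum -big_split; apply: eq_bigr => i _ /=.
    by rewrite -exprM -exprD /e mulnDl [(s i * _)%N]mulnC.
  have -> : \prod_(i < n.+1 | i \notin A) ((-1) ^+ s i * t ^+ k i) ^+ b i =
      (\prod_(i < n.+1 | i \notin A) ((-1) ^+ s i) ^+ b i) *
      \prod_(i < n.+1 | i \notin A) (t ^+ b i) ^+ k i :> K.
    rewrite -big_split; apply: eq_bigr => i _ /=.
    by rewrite exprMn -!exprM [(k i * _)%N]mulnC.
  by rewrite big_split /=; ring.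
under [LHS]eq_bigr do under eq_bigr do rewrite summandE.
under [LHS]eq_bigr do rewrite -2!mulr_sumr.
rewrite -mulr_sumr -mulr_suml sum_Kset sum_Sbar_sign //.
have -> : \prod_(i < n.+1 | i \notin A) outside i =
    (\prod_(i < n.+1 | i \notin A) (~~ odd (e i))%:R) *
    \prod_(i < n.+1 | i \notin A) (Fpoly t a i).[t ^+ b i].
  rewrite -big_split; apply: eq_bigr => i _ /=; congr (_%:R * _).
  by rewrite /e oddD; case: (odd _); case: (odd _).
(* The two cardinals add up to n+1, and the complement of [A] is nonempty. *)
have -> : 2 ^+ n = 2 ^+ #|A| * 2 ^+ #|~: A|.-1 :> K.
  rewrite -exprD; congr (_ ^+ _); have := cardsC A; rewrite card_ord.
  have : (0 < #|~: A|)%N.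
    have [m mA _] := is_min_notin_exists AT.
    by apply/card_gt0P; exists m; rewrite inE.
  by case: #|~: A| => // m _; rewrite addnS => -[].
ring.
Qed.

(** An index may lie in [A] only if a_i is even, and outside only if a_i is nonzero; a forbidden
    choice counts as 0. *)
Definition local_sum (i : 'I_n.+1) : K :=
  (if i \in Eset a then inside i else 0) +
  (if i \in Zset a then 0 else outside i).

(** Expanding the product gives one term for each set [A], and the inadmissible sets contribute
    0. *)
Lemma sum_prod_in_out : (0 < mdeg b)%N ->
  \sum_(A : {set 'I_n.+1} |
          [&& Zset a \subset A, A \subset Eset a & A != finset.setT])
    (\prod_(i in A) inside i) * (\prod_(i < n.+1 | i \notin A) outside i) =
  \prod_i local_sum i.
Proof.
move=> b_gt0; rewrite bigA_distr big_mkcond; apply: eq_bigr => A _.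
rewrite [RHS](bigID (mem A)) /=.
rewrite [X in _ = X * _](eq_bigr (fun i => if i \in Eset a then inside i else 0));
  last by move=> i ->.
rewrite [X in _ = _ * X](eq_bigr (fun i => if i \in Zset a then 0 else outside i));
  last by move=> i /negPf->.
have [ZA|/subsetPn[i iZ iA]] := boolP (Zset a \subset A); last first.
  by rewrite [X in _ = _ * X](bigD1 i) //= iZ mul0r mulr0.
have [AE|/subsetPn[i iA iE]] := boolP (A \subset Eset a); last first.
  by rewrite [X in _ = X * _](bigD1 i) //= (negPf iE) !mul0r.
(* The full set may be omitted: some b_i is nonzero, so its [inside] factor is 0. *)
case: eqP => /= [->|_].
  have /existsP[i bi] : [exists i, b i != 0%N].
    apply: contraLR b_gt0 => /existsPn b0; rewrite -eqn0Ngt mdeg_eq0.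
    by apply/eqP/mnmP => i; rewrite mnm0E; apply/eqP; have := b0 i; rewrite negbK.
  by rewrite (bigD1 i) ?inE //= /inside (negPf bi) mulr0 if_same !mul0r.
congr (_ * _); apply: eq_bigr => i iA.
  by rewrite (fintype.subsetP AE).
by rewrite ifF //; apply: contraNF iA; apply: (fintype.subsetP ZA).
Qed.

Lemma local_sum_small i : (b i < a i)%N -> local_sum i = 0.
Proof.
move=> lt_ba; rewrite /local_sum /inside /outside !inE.
have -> : a i == 0%N = false by case: (a i) lt_ba.
(* For b_i = 0: if a_i is odd neither choice contributes; if it is even, -F_i(1) cancels
   F_i(t^0). *)
have [bi0|bi_neq0] := eqVneq (b i) 0%N.
  rewrite bi0 expr0 eqbF_neg mulr1; case: (odd _) => /=.
    by rewrite mul0r addr0.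
  by rewrite mul1r addNr.
rewrite mulr0 if_same add0r; case: eqP => [parity|]; last by rewrite mul0r.
rewrite mul1r /Fpoly horner_prod.
(* Equal parity and 0 < b_i < a_i put this [j] between 1 and m_i, so t^(b_i) is a root of F_i. *)
pose j := ((a i - b i)./2)%N.
have def_b : (b i = a i - 2 * j)%N by rewrite /j; lia.
rewrite (bigD1_seq j) ?iota_uniq //=; first by rewrite hornerXsubC def_b subrr mul0r.
by rewrite mem_index_iota /mhalf /j; lia.
Qed.

End Coefficients.

(** * The diagonal exponent and the comparison of coefficients *)

Lemma mnm_exists_ltn (n : nat) (a b : 'X_{1..n}) :
  mdeg b = mdeg a -> b != a -> exists i, (b i < a i)%N.
Proof.
move=> deg_b neq_ba; apply/existsP; apply: contraR neq_ba => /existsPn no_lt.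
have le_ab : (a <= b)%MM by apply/mnm_lepP => i; rewrite leqNgt.
have := submK le_ab; have : (b - a)%MM == 0%MM.
  rewrite -mdeg_eq0 -(eqn_add2r (mdeg a)) -mdegD submK //.
  by rewrite deg_b.
by move=> /eqP->; rewrite add0m => ->.
Qed.

(** For a_i = 0 only [inside] remains and equals -1; otherwise it vanishes and [outside] gives
    F_i(t^(a_i)). *)
Lemma local_sum_diag (K : fieldType) (t : K) (n : nat) (a : 'X_{1..n.+1}) :
  \prod_i local_sum t a a i =
  (-1) ^+ #|Zset a| * \prod_(i < n.+1 | i \notin Zset a) (Fpoly t a i).[t ^+ a i].
Proof.
rewrite (bigID (mem (Zset a))) /=; congr (_ * _).
  rewrite -prodr_const; apply: eq_bigr => i.
  rewrite /local_sum /inside !inE => /eqP ai0; rewrite ai0 eqxx /= addr0 mulr1.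
  by rewrite /Fpoly /mhalf ai0 big_geq // hornerC.
apply: eq_bigr => i; rewrite /local_sum /inside /outside !inE => ai_neq0.
by rewrite (negPf ai_neq0) mulr0 if_same add0r eqxx mul1r.
Qed.

Theorem theorem2p4 (K : fieldType) (K_infinite : infinite_set [set: K])
    (t : K) (n : nat) (a : 'X_{1..n.+1}) (a_neq0 : (0 < mdeg a)%N) :
  Dcoef t a *: 'X_[a] =
  \sum_(A : {set 'I_n.+1} |
          [&& Zset a \subset A, A \subset Eset a & A != finset.setT])
    \sum_(k in Kset a A) \sum_(s in Sbar A)
      Ccoef t a A k s *: (ell t A k s) ^+ mdeg a :> {mpoly K[n.+1]}.
Proof.
apply/mpolyP => b; rewrite mcoeffZ mcoeffX raddf_sum /=.
under [RHS]eq_bigr do rewrite raddf_sum /=.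
under [RHS]eq_bigr do under eq_bigr do rewrite raddf_sum /=.
under [RHS]eq_bigr do under eq_bigr do under eq_bigr do rewrite mcoeffZ.
have [deg_b|deg_b] := eqVneq (mdeg b) (mdeg a); last first.
  rewrite (_ : a == b = false) ?mulr0; last first.
    by apply/eqP => ab; rewrite ab eqxx in deg_b.
  rewrite big1 // => A _; rewrite big1 // => k _; rewrite big1 // => s _.
  by rewrite mcoeff_ell_exp (negPf deg_b) mulr0.
rewrite (eq_bigr _ (fun A hA => sum_Ccoef_mcoeff t deg_b
  (proj1 (andP (proj2 (andP hA)))) (proj2 (andP (proj2 (andP hA)))))).
rewrite -mulr_sumr sum_prod_in_out ?deg_b //.
have [->|neq_ba] := eqVneq b a.
  by rewrite local_sum_diag mulr1 /Dcoef; ring.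
(* Off the diagonal some b_i is less than a_i, and that single local factor kills the product. *)
have [i lt_ba] := mnm_exists_ltn deg_b neq_ba.
by rewrite mulr0 (bigD1 i) //= local_sum_small // mul0r mulr0.
Qed.
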